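(* Fix $l>1$ and choose $\Delta$ to be a minimal dominating set for $\mathcal{Q}_l$. Set $(\theta,\xi)= \Theta(l+1)$. Suppose $S$ is an $m$-decomposition of $l$ for some $m \geq 0$ with the property that $m < \theta - |S|$. Then for any $(S,m)$-admissible subset $E \subseteq \Delta$, \[\gamma_{m+\theta+l} \leq 2^{m+\theta} \gamma_l - 2^m |E| .\] If $\check{l}+m + \theta < 2^{\widehat{l}}$, this translates to \[ \chi_{m+\theta+l} \geq \chi_{l} +2^{\widehat{l} -l - \theta} |E| .\]
   Context: $\mathcal{Q}_n$ is the $n$-dimensional hypercube, identified with binary words of length $n$ under Hamming distance. A set $\Delta\subseteq\mathcal{Q}_n$ is dominating if every vertex is within distance $1$ of some element of $\Delta$; $\gamma_n$ is the minimum size of a dominating set, and a dominating set of that size is minimal. For a positive integer $n$ write $n = 2^{\widehat{n}}-1+\check{n}$ with $0\le \check{n}<2^{\widehat{n}}$, and define $\chi_n := 1-\gamma_n\cdot 2^{\widehat{n}-n}$. For a positive integer $q$, $\Theta(q)$ is the unique pair $(\theta,\xi)$ of non-negative integers with $\binom{\theta+1}{2}=q+\xi$ and $0\le\xi<\theta+1$. With $(\theta,\xi)=\Theta(l+1)$ and $m\ge 0$, an $m$-decomposition of $l$ is a set $S=\{s_1,\dots,s_q\}$ with $1\le s_1<\dots<s_q<\theta$ and $\theta+m+\sum_{s\in S}s = l+1$; it splits a word of length $l$ into consecutive subwords of lengths $s_1,\dots,s_q,\theta-1,m$, and $\pi^{(s)}:\mathcal{Q}_l\to\mathcal{Q}_s$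 extracts the subword of length $s$ (choosing the leftmost such subword in case of ambiguity). A subset of a hypercube is $3$-separated if distinct elements are at distance at least $3$. A subset $E\subseteq\Delta$ of a minimal dominating set $\Delta$ of $\mathcal{Q}_l$ is $(S,m)$-admissible if $\pi^{(s)}(E)\subseteq\mathcal{Q}_s$ is $3$-separated for every $s\in S$. *)

(* Defs.v *)
From mathcomp Require Import all_boot all_order all_algebra.

Set Implicit Arguments.
Unset Strict Implicit.
Unset Printing Implicit Defensive.

Import Order.TTheory GRing.Theory Num.Theory.

Notation hypercube n := (n.-tuple bool).

Definition hamming n (x y : hypercube n) : nat :=
  #|[set i : 'I_n | tnth x i != tnth y i]|.

Definition dominating n (D : {set hypercube n}) : bool :=
  [forall x, exists y in D, hamming x y <= 1].

Lemma hammingxx n (x : hypercube n) : hamming x x = 0.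
Proof. by apply: eq_card0 => i; rewrite inE eqxx. Qed.

(* The default value of the argmin in [gamma] is dominating, so [arg_minnP]
   applies. *)
Lemma dominatingT n : dominating [set: hypercube n].
Proof. by apply/forallP => x; apply/exists_inP; exists x; rewrite ?hammingxx. Qed.

Definition gamma n : nat :=
  #|[arg min_(D < [set: hypercube n] | dominating D) #|D| ]|.

(* Minimal in cardinality, not merely with respect to inclusion. *)
Definition min_dominating n (D : {set hypercube n}) : bool :=
  dominating D && (#|D| == gamma n).

(* [n = 2 ^ hat n - 1 + check n] with [0 <= check n < 2 ^ hat n]; this
   determines the pair, see [hat_checkP] and [hat_check_uniq]. *)
Definition hat (n : nat) : nat := trunc_log 2 n.+1.
Definition check (n : nat) : nat := n.+1 - 2 ^ hat n.

Lemma hat_checkP n : n = 2 ^ hat n - 1 + check n /\ check n < 2 ^ hat n.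
Proof.
have /andP[le_n lt_n] : 2 ^ hat n <= n.+1 < 2 ^ (hat n).+1.
  by apply: trunc_log_bounds.
have gt0 : 0 < 2 ^ hat n by rewrite expn_gt0.
split; rewrite /check; first by rewrite addnBAC // subnKC // subn1.
by rewrite ltn_subLR // addnn -mul2n -expnS.
Qed.

Lemma hat_check_uniq n a b :
  n = 2 ^ a - 1 + b -> b < 2 ^ a -> a = hat n /\ b = check n.
Proof.
move=> En lt_b; have gt0 : 0 < 2 ^ a by rewrite expn_gt0.
have En1 : n.+1 = 2 ^ a + b by rewrite En -addSn subn1 prednK.
have Ea : a = hat n.
  apply/esym/trunc_log_eq => //.
  by rewrite En1 leq_addr expnS mul2n -addnn ltn_add2l.
by split=> //; rewrite /check -Ea En1 addKn.
Qed.

Definition chi (n : nat) : rat :=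
  (1 - (gamma n)%:R * 2%:R ^ ((hat n)%:Z - n%:Z))%R.

(* [Theta q theta xi] reads "(theta, xi) = Theta(q)". When [q = 'C(t, 2)] with
   [t > 0], the bound [xi < theta + 1] admits both [(t - 1, 0)] and [(t, t)],
   so this is a relation rather than a function. *)
Definition Theta (q theta xi : nat) : Prop :=
  'C(theta.+1, 2) = q + xi /\ xi < theta.+1.

(* The finite set S is represented by its increasing enumeration. *)
Definition decomposition (l theta m : nat) (S : seq nat) : Prop :=
  [/\ sorted ltn S,
      all (fun s => 1 <= s < theta) S
    & theta + m + \sum_(s <- S) s = l.+1].

Definition block_lengths (theta m : nat) (S : seq nat) : seq nat :=
  S ++ [:: theta - 1; m].

(* The leftmost block of length s when a word is cut into consecutive blocks
   of the given lengths: [index] finds its first occurrence and [sumn] its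
   offset. Only meaningful for [s \in lengths] and [sumn lengths = l]. *)
Definition subword (lengths : seq nat) (s l : nat) (w : hypercube l) :
    hypercube s :=
  [tuple nth false w (sumn (take (index s lengths) lengths) + i) | i < s].

Definition separated3 n (A : {set hypercube n}) : Prop :=
  {in A &, forall x y, x != y -> 3 <= hamming x y}.

Definition admissible l (theta m : nat) (S : seq nat)
    (E : {set hypercube l}) : Prop :=
  forall s, s \in S ->
    separated3 [set subword (block_lengths theta m S) s w | w in E].

(* Main.v *)
Require Import Defs.
From mathcomp Require Import all_boot all_order all_algebra.
From mathcomp Require Import zify lra.

(* Given a in Q_theta and d = the position of its leading 1, the words a with
   leading 1 at d form a d-dimensional subcube; these subcubes partition
   Q_theta minus the origin 0, and the base point of each of them is adjacent
   to 0. In Q_theta x Q_l start from Q_theta x Delta and delete {0} x E. This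
   leaves uncovered at a = 0 at most the l + 1 points of the ball around each
   e in E, and the fibres over the base points have to cover them.
   Over the subcube of dimension d, 0 < d < theta, translating Delta by one
   coordinate covers one point of each ball, and the subcube of dimension 0
   covers its centre: theta points in all, the centre and the block of length
   theta - 1. If moreover d is in S, write w = (y, z) with y the block of length
   d, and use {(x, w) | (psi y + x, z) in Delta}, where psi contracts the
   disjoint radius-1 balls around the projections of E to their centres. This is
   still dominating and has 2^d |Delta| elements, because x runs over all of
   Q_d; at x = 0 it contains every e changed in one coordinate of block d.
   The last m coordinates are dealt with by m more dimensions: over b in Q_m the
   construction is translated by b in those coordinates of Q_l, and its origin
   in Q_theta is moved by the parity of b, so that the deleted points over
   adjacent b do not meet. *)

Set Implicit Arguments.
Unset Strict Implicit.
Unset Printing Implicit Defensive.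

Import Order.TTheory GRing.Theory Num.Theory.

(** * Coordinate flips and radius-1 balls *)

Section Flip.
Local Open Scope nat_scope.

(* Indices i >= n are allowed and leave x unchanged, so that the radius-1 ball
   around x is exactly {flip i x | i : nat}. *)
Definition flip n (i : nat) (x : hypercube n) : hypercube n :=
  [tuple tnth x j (+) (i == j) | j < n].
Arguments flip : simpl never.

Lemma size_flip n i (x : hypercube n) : size (flip i x) = n.
Proof. exact: size_tuple. Qed.

Lemma tnth_flip n i (x : hypercube n) j :
  tnth (flip i x) j = tnth x j (+) (i == j).
Proof. exact: tnth_mktuple. Qed.

Lemma nth_flip n i (x : hypercube n) j :
  j < n -> nth false (flip i x) j = nth false x j (+) (i == j).
Proof. by move=> ltjn; rewrite -!(tnth_nth _ _ (Ordinal ltjn)) tnth_flip. Qed.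

Lemma flip_out n i (x : hypercube n) : n <= i -> flip i x = x.
Proof.
move=> leni; apply: eq_from_tnth => j; rewrite tnth_flip.
by rewrite gtn_eqF ?addbF // (leq_trans (ltn_ord j)).
Qed.

Lemma flipK n i : involutive (@flip n i).
Proof. by move=> x; apply: eq_from_tnth => j; rewrite !tnth_flip addbK. Qed.

Lemma flipC n i j (x : hypercube n) : flip i (flip j x) = flip j (flip i x).
Proof. by apply: eq_from_tnth => k; rewrite !tnth_flip addbAC. Qed.

Lemma hamming_sym n (x y : hypercube n) : hamming x y = hamming y x.
Proof. by apply: eq_card => i; rewrite !inE eq_sym. Qed.

Lemma hamming_flip n i (x : hypercube n) : hamming x (flip i x) <= 1.
Proof.
have [ltin | /flip_out ->] := ltnP i n; last by rewrite hammingxx.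
rewrite -(cards1 (Ordinal ltin)); apply/subset_leq_card/subsetP => j.
rewrite !inE tnth_flip -val_eqE /= [_ == i]eq_sym.
by case: (i == j) => //; rewrite addbF eqxx.
Qed.

Lemma hamming_le1 n (x y : hypercube n) :
  hamming x y <= 1 -> exists i, y = flip i x.
Proof.
rewrite leq_eqVlt ltnS leqn0 => /orP[/cards1P[i Ei] | /eqP/cards0_eq Exy].
  exists i; apply: eq_from_tnth => j; rewrite tnth_flip.
  move/setP/(_ j): Ei; rewrite !inE -val_eqE [val j == _]eq_sym /= => <-.
  by case: (tnth x j); case: (tnth y j).
exists n; rewrite flip_out //; apply: eq_from_tnth => j.
by move/setP/(_ j): Exy; rewrite !inE => /negbFE/eqP.
Qed.

Lemma hamming_triangle n (x y z : hypercube n) :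
  hamming x z <= hamming x y + hamming y z.
Proof.
apply: leq_trans (leq_card_setU _ _); apply/subset_leq_card/subsetP => i.
by rewrite !inE; case: (tnth x i); case: (tnth y i); case: (tnth z i).
Qed.

Lemma dominatingP n (D : {set hypercube n}) :
  reflect (forall x, exists i, flip i x \in D) (dominating D).
Proof.
apply: (iffP forallP) => domD x.
  have /exists_inP[y yD /hamming_le1[i Ey]] := domD x.
  by exists i; rewrite -Ey.
by have [i xiD] := domD x; apply/exists_inP; exists (flip i x) => //;
  apply: hamming_flip.
Qed.

Lemma gamma_le n (D : {set hypercube n}) : dominating D -> gamma n <= #|D|.
Proof.
by rewrite /gamma; case: arg_minnP => [|A _ minA /minA]; first exact: dominatingT.
Qed.

Lemma flip_cons0 n b (x : hypercube n) :
  flip 0 [tuple of b :: x] = [tuple of ~~ b :: x].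
Proof.
apply: eq_from_tnth => j; rewrite tnth_flip !(tnth_nth false) /=.
by case: j => -[|j] ltj /=; rewrite ?addbF ?addbT.
Qed.

Lemma flip_consS n i b (x : hypercube n) :
  flip i.+1 [tuple of b :: x] = [tuple of b :: flip i x].
Proof.
apply: eq_from_tnth => j; rewrite tnth_flip !(tnth_nth false) /=.
by case: j => -[|j] ltj /=; rewrite ?addbF ?nth_flip.
Qed.

Lemma flip_catl m n i (x : hypercube m) (y : hypercube n) : i < m ->
  flip i [tuple of x ++ y] = [tuple of flip i x ++ y].
Proof.
move=> ltim; apply: eq_from_tnth => j; rewrite tnth_flip !(tnth_nth false) /=.
rewrite !nth_cat ?size_flip !size_tuple; case: ifP => ltjm; rewrite ?nth_flip //.
by rewrite ltn_eqF ?addbF // (leq_trans ltim) // leqNgt ltjm.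
Qed.

Lemma flip_catr m n i (x : hypercube m) (y : hypercube n) :
  flip (m + i) [tuple of x ++ y] = [tuple of x ++ flip i y].
Proof.
apply: eq_from_tnth => j; rewrite tnth_flip !(tnth_nth false) /=.
have ltj := ltn_ord j.
rewrite !nth_cat ?size_flip !size_tuple; case: ifP => ltjm.
  by rewrite gtn_eqF ?addbF // ltn_addr.
have [lemj ltjn] : m <= j /\ j - m < n by lia.
by rewrite nth_flip //; congr (_ (+) _); lia.
Qed.

Lemma cat_tuple_split T m n (x : (m + n).-tuple T) :
  exists (y : m.-tuple T) (z : n.-tuple T), x = [tuple of y ++ z].
Proof.
elim: m x => [|m IHm] x; first by exists [tuple], x; apply: val_inj.
case/tupleP: x => b x; have [y [z Ex]] := IHm x.
by exists [tuple of b :: y], z; apply: val_inj; rewrite Ex.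
Qed.

End Flip.

(** * Stacking fibres over the leading-1 subcubes *)

Section Staircase.
Local Open Scope nat_scope.

Variables (l : nat) (Delta E : {set hypercube l}).
Variable G : nat -> seq bool -> pred (hypercube l).

(** A plain sequence, so that the tail after the first [true] gives both the point of the subcube
    and, by its length, the dimension. *)
Fixpoint stair (a : seq bool) : pred (hypercube l) :=
  match a with
  | [::] => mem (Delta :\: E)
  | true :: x => G (size x) x
  | false :: x => stair x
  end.

Lemma stair_nseq k a w : stair (nseq k false ++ a) w = stair a w.
Proof. by elim: k. Qed.

(** Off the origin each subcube dominates itself; over the origin only the balls around [E] can
    fail, and every adjacent base point may still cover them. *)
Lemma stair_dominated n (a : hypercube n) w :
    dominating Delta ->
    (forall d (x : hypercube d) v, d < n ->
       exists i, G d (flip i x) v \/ G d x (flip i v)) ->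
  (exists i, stair (flip i a) w \/ stair a (flip i w)) \/
  (a = nseq n false :> seq bool /\ exists e i, [/\ e \in E, w = flip i e
     & forall d, d < n -> ~~ G d (nseq d false) w]).
Proof.
move=> /dominatingP domDelta; elim: n a => [|n IHn] a domG.
  have [i Di] := domDelta w; rewrite [a]tuple0.
  case Ei: (flip i w \in E); last by left; exists i; right; rewrite /= inE Ei.
  right; split=> //; exists (flip i w), i; split=> //.
  by rewrite flipK.
case/tupleP: a => -[] a'.
  have [i [Gi|Gi]] := domG n a' w (ltnSn n); left.
    by exists i.+1; left; rewrite flip_consS /= size_flip.
  by exists i; right; rewrite /= size_tuple.
have [d x v lt_dn|[i [Ai|Ai]]|[Ea [e [i [eE -> nG]]]]] := IHn a'.
- exact/domG/ltnW.
- by left; exists i.+1; left; rewrite flip_consS.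
- by left; exists i; right.
(* Flipping the head of the zero word gives the base point of the subcube of dimension [n]. *)
case Gn: (G n (nseq n false) (flip i e)).
  by left; exists 0; left; rewrite flip_cons0 /= size_tuple Ea.
right; rewrite /= Ea; split=> //; exists e, i; split=> // d.
by rewrite ltnS leq_eqVlt => /predU1P[->|/nG//]; rewrite Gn.
Qed.

(** The subcubes and the origin add up by 1 + (1 + 2 + ... + 2^(n-1)) = 2^n; the origin saves
    [#|E|]. *)
Lemma card_stair n :
    E \subset Delta ->
    (forall d, d < n ->
       #|[set p : hypercube d * hypercube l | G d p.1 p.2]| <= 2 ^ d * #|Delta|) ->
  #|[set p : hypercube n * hypercube l | stair p.1 p.2]| + #|E|
    <= 2 ^ n * #|Delta|.
Proof.
move=> sED; elim: n => [|n IHn] cardG.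
  rewrite mul1n -(cardsID E Delta) (setIidPr sED) addnC leq_add2l.
  apply: leq_trans (leq_imset_card (pair [tuple of [::]]) _).
  apply/subset_leq_card/subsetP => -[a w]; rewrite [a]tuple0 inE /= => Aw.
  exact: imset_f.
pose cons_fst b (p : hypercube n * hypercube l) := ([tuple of b :: p.1], p.2).
set A := [set p : hypercube n * hypercube l | stair p.1 p.2] in IHn.
set B := [set p : hypercube n * hypercube l | G n p.1 p.2].
set A' := [set p : hypercube n.+1 * hypercube l | stair p.1 p.2].
have /subset_leq_card sub : A' \subset cons_fst true @: B :|: cons_fst false @: A.
  apply/subsetP => -[a w]; case/tupleP: a => b a; rewrite !inE /= => Aw.
  apply/orP; case: b Aw => Aw; [left|right]; apply/imsetP; exists (a, w) => //.
    by rewrite size_tuple in Aw; rewrite inE.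
  by rewrite inE.
have := leq_trans sub (leq_card_setU _ _).
have := leq_imset_card (cons_fst true) B.
have := leq_imset_card (cons_fst false) A.
have := cardG n (ltnSn n); have := IHn (fun d lt => cardG d (ltnW lt)).
rewrite -/B expnS; lia.
Qed.

End Staircase.

(** * Fibres over the subcubes with dimension in [S] *)

Section Recode.
Local Open Scope nat_scope.

Variables (l d o k : nat) (C : {set hypercube d}).

Definition window (w : hypercube l) : hypercube d :=
  [tuple nth false w (o + i) | i < d].

Definition retract (y : hypercube d) : hypercube d :=
  odflt y [pick c in C | hamming c y <= 1].

(* With (y, z) the splitting of w into its window and the rest, this is
   (retract y + x, z), with the bit k of z also flipped when y \in C: only the
   windows at distance 1 from C are needed for the points of the balls inside
   the window, so those in C are free to cover the point in direction k. *)
Definition recode (x : seq bool) (w : hypercube l) : hypercube l :=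
  [tuple if o <= i < o + d
         then nth false (retract (window w)) (i - o) (+) nth false x (i - o)
         else tnth w i (+) ((k == i) && (window w \in C)) | i < l].

Lemma window_flip i w : o + d <= l ->
  window (flip i w) =
    if o <= i < o + d then flip (i - o) (window w) else window w.
Proof.
move=> led; case: ifP => io; apply: eq_from_tnth => j; have ltj := ltn_ord j;
  rewrite ?tnth_flip !tnth_mktuple nth_flip; lia.
Qed.

(** A flip inside the window is absorbed by [x]; one outside leaves the window, hence its
    retraction, unchanged and passes to [w]. *)
Lemma recode_dominated (Delta : {set hypercube l}) (x : hypercube d) w :
    o + d <= l -> dominating Delta ->
  exists i, recode (flip i x) w \in Delta \/ recode x (flip i w) \in Delta.
Proof.
move=> led /dominatingP/(_ (recode x w))[i Di].
case io: (o <= i < o + d).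
  exists (i - o); left; congr (_ \in Delta): Di.
  apply: eq_from_tnth => j; rewrite tnth_flip !tnth_mktuple.
  case: ifP => jo; last by rewrite (_ : (i == j) = false) ?addbF //; lia.
  rewrite nth_flip; last lia.
  by rewrite addbA; congr (_ (+) _); lia.
exists i; right; congr (_ \in Delta): Di.
apply: eq_from_tnth => j; rewrite tnth_flip !tnth_mktuple window_flip // io.
case: ifP => jo; first by rewrite (_ : (i == j) = false) ?addbF //; lia.
by rewrite addbAC.
Qed.

(* The pair (window w, recode x w) determines (x, w) even though retract is
   not injective. *)
Lemma card_recode (Delta : {set hypercube l}) :
    o + d <= l ->
  #|[set p : hypercube d * hypercube l | recode p.1 p.2 \in Delta]|
    <= 2 ^ d * #|Delta|.
Proof.
move=> led.
pose f (p : hypercube d * hypercube l) := (window p.2, recode p.1 p.2).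
have injf : injective f.
  move=> [x w] [x' w'] Ef; have /= Ey := congr1 fst Ef; 
    have /= Er := congr1 snd Ef.
  congr (_, _); apply: eq_from_tnth => j.
    have ltj : o + j < l by have := ltn_ord j; lia.
    have := congr1 (fun t => tnth t (Ordinal ltj)) Er.
    rewrite !tnth_mktuple /= leq_addr ltn_add2l ltn_ord addKn Ey -!tnth_nth.
    exact: addbI.
  case jo: (o <= j < o + d).
    have ltj : j - o < d by lia.
    have := congr1 (fun t => tnth t (Ordinal ltj)) Ey.
    by rewrite !tnth_mktuple /= subnKC -?tnth_nth //; lia.
  have := congr1 (fun t => tnth t j) Er.
  by rewrite !tnth_mktuple jo Ey => /addIb.
rewrite -(card_imset _ injf) -card_bool -card_tuple -cardsT -cardsX.
apply/subset_leq_card/subsetP => _ /imsetP[p Dp ->].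
by rewrite !inE in Dp *.
Qed.

Lemma retract_id c i : separated3 C -> c \in C -> retract (flip i c) = c.
Proof.
move=> sepC cC; rewrite /retract; case: pickP => [c' /andP[c'C c'i]|] /=.
  apply/eqP/contraT => /sepC-/(_ c'C cC); rewrite leqNgt => /negP[].
  rewrite ltnS -[2]/(1 + 1); apply: leq_trans (hamming_triangle _ (flip i c) _) _.
  by rewrite leq_add // hamming_sym hamming_flip.
by move/(_ c); rewrite cC hamming_flip.
Qed.

(** Inside the window [retract] undoes the flip; in direction [k] the window stays in [C], so the
    extra flip undoes it. *)
Lemma recode_flip i (e : hypercube l) :
    separated3 C -> window e \in C -> o + d <= l -> ~~ (o <= k < o + d) ->
    (o <= i < o + d) || (i == k) ->
  recode (nseq d false) (flip i e) = e.
Proof.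
move=> sepC eC led ko ik; apply: eq_from_tnth => j.
rewrite tnth_mktuple window_flip //.
have -> : retract (if o <= i < o + d then flip (i - o) (window e) else window e)
          = window e.
  case: ifP => _; first exact: retract_id.
  by rewrite -{1}(flip_out (window e) (leqnn d)) retract_id.
case: ifP => jo.
  have ltj : j - o < d by lia.
  rewrite nth_nseq if_same addbF -(tnth_nth _ _ (Ordinal ltj)) tnth_mktuple /=.
  by rewrite subnKC -?tnth_nth //; lia.
rewrite tnth_flip; case: ifP ik => io /=; last first.
  by move/eqP <-; rewrite eC andbT addbK.
move=> _; rewrite (_ : (i == j) = false) ?addbF; last lia.
(* In [C] this word would retract both to itself and to [window e]. *)
suff /negbTE -> : flip (i - o) (window e) \notin C by rewrite andbF addbF.
have lti : i - o < d by lia.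
apply/negP => fC; have := retract_id d sepC fC.
rewrite flip_out // retract_id // => /(congr1 (fun t => tnth t (Ordinal lti))).
by rewrite tnth_flip eqxx addbT; case: (tnth _ _).
Qed.

End Recode.

(** * The [m] extra dimensions *)

Section Twist.
Local Open Scope nat_scope.

Variables (m n l g : nat).

Definition parity (b : hypercube m) : bool := \big[addb/false]_(j < m) tnth b j.

Definition shift (b : hypercube m) (w : hypercube l) : hypercube l :=
  [tuple tnth w j (+) ((l - m <= j) && nth false b (j - (l - m))) | j < l].

Definition twist (b : hypercube m) (p : hypercube n * hypercube l) :=
  (if parity b then flip g p.1 else p.1, shift b p.2).

Lemma parity_flip i b : i < m -> parity (flip i b) = ~~ parity b.
Proof.
move=> ltim; rewrite /parity; under eq_bigr do rewrite tnth_flip.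
rewrite big_split (bigD1 (Ordinal ltim) (F := fun j => i == j)) //= eqxx.
rewrite [X in _ (+) (_ (+) X)]big1 ?addbT // => j.
by rewrite -val_eqE eq_sym => /negbTE.
Qed.

Lemma shift_flip i b w : i < m -> shift (flip i b) w = flip (l - m + i) (shift b w).
Proof.
move=> ltim; apply: eq_from_tnth => j; rewrite tnth_flip !tnth_mktuple.
have ltj := ltn_ord j; rewrite -addbA; congr (_ (+) _).
case: leqP => lej /=; last lia.
by rewrite nth_flip; [congr (_ (+) _); lia | lia].
Qed.

Lemma shift_flipr i b w : shift b (flip i w) = flip i (shift b w).
Proof. by apply: eq_from_tnth => j; rewrite !(tnth_flip, tnth_mktuple) addbAC. Qed.

Lemma shiftK b : involutive (shift b).
Proof. by move=> w; apply: eq_from_tnth => j; rewrite !tnth_mktuple addbK. Qed.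

Lemma twistK b : involutive (twist b).
Proof.
by case=> a w; rewrite /twist /= shiftK; case: (parity b); rewrite ?flipK.
Qed.

(** For fixed [b] the twist is a bijection preserving adjacency, which gives the first alternative;
    changing entry [j] of [b] flips [g] and [l - m + j] at once, which gives the second. *)
Lemma gamma_twist (A : {set hypercube n * hypercube l}) :
    (forall a w,
       (exists i, (flip i a, w) \in A \/ (a, flip i w) \in A) \/
       (exists2 j, j < m & (flip g a, flip (l - m + j) w) \in A)) ->
  gamma (m + n + l) <= 2 ^ m * #|A|.
Proof.
move=> domA.
pose B := [set p : hypercube m * (hypercube n * hypercube l) | twist p.1 p.2 \in A].
pose f (p : hypercube m * (hypercube n * hypercube l)) :=
  [tuple of [tuple of p.1 ++ p.2.1] ++ p.2.2].
have cardB : #|B| <= 2 ^ m * #|A|.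
  pose h (p : hypercube m * (hypercube n * hypercube l)) := (p.1, twist p.1 p.2).
  have injh : injective h.
    move=> [b p] [b' p'] Eh; have /= Eb := congr1 fst Eh.
    by have /= := congr1 snd Eh; rewrite -Eb => /(can_inj (twistK b)) ->.
  rewrite -(card_imset _ injh) -card_bool -card_tuple -cardsT -cardsX.
  apply/subset_leq_card/subsetP => _ /imsetP[p Bp ->].
  by rewrite !inE in Bp *.
apply: leq_trans cardB; apply: leq_trans (leq_imset_card f B).
apply/gamma_le/dominatingP => x.
have [b [a [w ->]]] : exists b a w, x = f (b, (a, w)).
  have [y [w ->]] := cat_tuple_split x; have [b [a ->]] := cat_tuple_split y.
  by exists b, a, w.
rewrite /f /=.
have [] := domA (twist b (a, w)).1 (twist b (a, w)).2; rewrite /twist /=.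
  case=> i [Ai | Ai].
    have : (b, (flip i a, w)) \in B.
      by rewrite inE /twist /=; case: (parity b) Ai => //; rewrite flipC.
    move/(imset_f f) => fB.
    have [lein | ltni] := leqP n i.
      by exists (m + n + l); move: fB; rewrite !flip_out.
    by exists (m + i); rewrite flip_catl ?flip_catr ?ltn_add2l.
  exists (m + n + i); rewrite flip_catr; apply/imsetP; exists (b, (a, flip i w)) => //.
  by rewrite inE /twist /= shift_flipr.
case=> j ltj Aj; exists j; rewrite flip_catl ?flip_catl; try lia.
apply/imsetP; exists (flip j b, (a, w)) => //.
rewrite inE /twist /= parity_flip // shift_flip //.
by move: Aj; case: (parity b) => //=; rewrite flipK.
Qed.

End Twist.

(** * Assembling the dominating set *)

Section GammaBound.
Local Open Scope nat_scope.

Lemma sumn_take_le (S : seq nat) r : sumn (take r S) <= sumn S.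
Proof. by rewrite -{2}(cat_take_drop r S) sumn_cat leq_addr. Qed.

Lemma sumn_locate (S : seq nat) i : i < sumn S ->
  exists2 r, r < size S & sumn (take r S) <= i < sumn (take r S) + nth 0 S r.
Proof.
elim: S i => //= s S IHS i lti; have [ltis | leis] := ltnP i s; first by exists 0.
have [|r ltr ir] := IHS (i - s); first lia.
by exists r.+1 => //=; lia.
Qed.

Lemma gamma_stair l (Delta E : {set hypercube l}) theta m S :
    0 < theta -> dominating Delta -> E \subset Delta ->
    decomposition l theta m S -> admissible theta m S E ->
  gamma (m + theta + l) + 2 ^ m * #|E| <= 2 ^ (m + theta) * #|Delta|.
Proof.
move=> theta_gt0 domD sED [sortS /allP boundS]; rewrite -sumnE => sumS admE.
have uniqS : uniq S by apply: sorted_uniq sortS; [apply: ltn_trans | apply: ltnn].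
pose L := block_lengths theta m S.
pose off (d : nat) := sumn (take (index d L) L).
have off_nth r : r < size S -> off (nth 0 S r) = sumn (take r S).
  move=> ltr; rewrite /off index_cat mem_nth // index_uniq //.
  by rewrite take_cat ltr.
have off_le d : d \in S -> off d + d <= sumn S.
  case/(nthP 0) => r ltr <-.
  by rewrite off_nth // -sumn_rcons -take_nth // sumn_take_le.
(* [subword L d] unfolds to the window at [off d], so admissibility makes [C d] 3-separated for [d]
   in [S]. *)
pose C d : {set hypercube d} := [set subword L d w | w in E].
(* Dimension 0 covers the centres, as [flip l] is the identity; dimensions 1 to [theta - 1] run
   through the block of length [theta - 1]. *)
pose k d := if d is d'.+1 then sumn S + d' else l.
pose G (d : nat) (x : seq bool) (w : hypercube l) :=
  (if d \in S then recode (off d) (k d) (C d) x w else flip (k d) w) \in Delta.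
have ltS d : d \in S -> 0 < d < theta by exact: boundS.
have G0 x w : G 0 x w = (w \in Delta).
  by rewrite /G ifN ?flip_out //; apply/negP => /ltS.
have G_spot (d i : nat) e :
    e \in E -> d < theta ->
    (i == k d) || (d \in S) && (off d <= i < off d + d) ->
  G d (nseq d false) (flip i e).
  move=> eE ltd ik; have eD := subsetP sED _ eE.
  rewrite /G; case: ifP ik => dS ik; last first.
    by move: ik; rewrite orbF => /eqP ->; rewrite flipK.
  have led := off_le d dS.
  rewrite recode_flip //.
  - exact: admE.
  - exact: imset_f.
  - lia.
  - by have := ltS d dS; rewrite /k; case: (d) led => //; lia.
  - by rewrite orbC.
pose A := [set p : hypercube theta * hypercube l | stair Delta E G p.1 p.2].
have cardA : #|A| + #|E| <= 2 ^ theta * #|Delta|.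
  apply: (@card_stair _ _ _ G theta sED) => d ltd; rewrite /G.
  case dS: (d \in S); first by apply: card_recode; have := off_le d dS; lia.
  pose f (p : hypercube d * hypercube l) := (p.1, flip (k d) p.2).
  have injf : injective f by apply: (@can_inj _ _ _ f) => -[x w]; rewrite /f /= flipK.
  rewrite -(card_imset _ injf) -card_bool -card_tuple -cardsT -cardsX.
  apply/subset_leq_card/subsetP => _ /imsetP[p Dp ->].
  by rewrite !inE in Dp *.
suff gammaA : gamma (m + theta + l) <= 2 ^ m * #|A|.
  by rewrite expnD -mulnA; nia.
(* Flipping the last entry takes the origin to the subcube of dimension 0, whose fibre is all of
   [Delta]. *)
apply: (@gamma_twist m theta l theta.-1) => a w.
have [d x v ltd | [i [Ai | Ai]] | [Ea [e [i [eE Ew nG]]]]]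
  := @stair_dominated l Delta E G theta a w domD.
- rewrite /G; case dS: (d \in S).
    by apply: recode_dominated => //; have := off_le d dS; lia.
  have [i Di] := elimT (dominatingP _) domD (flip (k d) v).
  by exists i; right; rewrite flipC.
- by left; exists i; left; rewrite inE.
- by left; exists i; right; rewrite inE.
right.
(* An uncovered direction avoids the blocks of [S], the block of length [theta - 1] and the centre,
   so it is among the last [m]. *)
have NG d : d < theta -> ~~ ((i == k d) || (d \in S) && (off d <= i < off d + d)).
  move=> ltd; apply/negP => ik; have := nG d ltd.
  by rewrite Ew G_spot.
have lei : sumn S <= i.
  rewrite leqNgt; apply/negP => /sumn_locate[r ltr ir].
  have rS := mem_nth 0 ltr; have := NG _ (proj2 (andP (ltS _ rS))).
  by rewrite rS off_nth // ir orbT.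
have lei' : sumn S + theta.-1 <= i.
  rewrite leqNgt; apply/negP => lti; have := NG (i - sumn S).+1.
  by rewrite /= subnKC // eqxx /=; lia.
have ltil : i < l.
  rewrite ltnNge; apply/negP => leli; have := nG 0 theta_gt0.
  by rewrite G0 Ew flip_out // (subsetP sED).
exists (i - (l - m)); first lia.
rewrite subnKC; last lia.
rewrite Ew flipK inE /=.
have -> : flip theta.-1 a = nseq theta.-1 false ++ [:: true] :> seq bool.
  apply: (@eq_from_nth _ false) => [|j].
    by rewrite size_flip size_cat size_nseq addn1 prednK.
  rewrite size_flip => ltj; rewrite nth_flip // Ea nth_cat size_nseq !nth_nseq ltj.
  case: ltngtP => [| | ->] //=; first by lia.
  by rewrite subnn.
by rewrite stair_nseq /= G0 (subsetP sED).
Qed.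

End GammaBound.

(** * From [gamma] to [chi] *)

Local Open Scope ring_scope.

Theorem theorem2 (l : nat) (hl : (1 < l)%N)
    (Delta : {set hypercube l}) (hDelta : min_dominating Delta)
    (theta xi : nat) (hTheta : Theta l.+1 theta xi)
    (m : nat) (S : seq nat) (hS : decomposition l theta m S)
    (hm : (m < theta - size S)%N)
    (E : {set hypercube l}) (hEDelta : E \subset Delta)
    (hE : admissible theta m S E) :
  ((gamma (m + theta + l))%:R : rat)
    <= 2%:R ^+ (m + theta) * (gamma l)%:R - 2%:R ^+ m * #|E|%:R
  /\ ((check l + m + theta < 2 ^ hat l)%N ->
      chi (m + theta + l)
        >= chi l + 2%:R ^ ((hat l)%:Z - l%:Z - theta%:Z) * #|E|%:R).
Proof.
have theta_gt0 : (0 < theta)%N by lia.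
have /andP[domD /eqP cardD] := hDelta.
have bound : ((gamma (m + theta + l))%:R : rat)
    <= 2%:R ^+ (m + theta) * (gamma l)%:R - 2%:R ^+ m * #|E|%:R.
  rewrite lerBrDr -!natrX -!natrM -natrD ler_nat -cardD.
  exact: (gamma_stair theta_gt0 domD hEDelta hS hE).
split=> // small.
(* By [small] no further power of 2 is reached, so [hat] keeps its value. *)
have eq_l : (m + theta + l = 2 ^ hat l - 1 + (check l + m + theta))%N.
  by have [] := hat_checkP l; lia.
have [hat_eq _] := hat_check_uniq eq_l small.
rewrite /chi -hat_eq.
(* The claim is [bound] multiplied by [t]. *)
set t : rat := 2%:R ^ ((hat l)%:Z - (m + theta + l)%:Z).
have shift_exp (e : int) k : e = (hat l)%:Z - (m + theta + l)%:Z + k%:Z ->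
    (2%:R : rat) ^ e = t * 2%:R ^+ k.
  by move=> ->; rewrite expfzDr.
rewrite (shift_exp _ (m + theta)%N); last by lia.
rewrite (shift_exp _ m); last by lia.
have t_ge0 : 0 <= t by rewrite exprz_ge0.
by have := ler_wpM2l t_ge0 bound; lra.
Qed.
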